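(* Let $K$ be a b-convex body in a Minkowski space $(\mathbb{R}^n,\|\cdot\|)$. (a) For every $x_0 \in \operatorname{bd}(K)$, there exists a supporting sphere $S(y_0,1)$ of $K$ such that $x_0 \in S(y_0,1)$. (b) For every $x_0 \in \mathbb{R}^n \setminus K$, there exists a supporting sphere $S(y_0,1)$ of $K$ such that $x_0 \notin B(y_0,1)$. (c) If $K$ is b-bounded then, for every $x_0 \in \mathbb{R}^n \setminus K$, there exists a sphere of unit radius $S(y_0,1)$ such that $K \subseteq \operatorname{int}(B(y_0,1))$ and $x_0 \notin B(y_0,1)$. In particular, $K \subseteq B(y_0,r)$ for some $r \in (0,1)$.
   Context: A Minkowski space $(\mathbb{R}^n,\|\cdot\|)$ is $\mathbb{R}^n$, $n\ge 1$, equipped with an arbitrary norm. For $x\in\mathbb{R}^n$ and $r\ge 0$, $B(x,r)=\{y:\|y-x\|\le r\}$ is the closed ball and $S(x,r)=\{y:\|y-x\|=r\}$ the sphere; $\operatorname{int}$ and $\operatorname{bd}$ denote interior and boundary. The ball hull of $S\subseteq\mathbb{R}^n$ is $\operatorname{bh}_1(S)=\bigcap_{x\in\mathbb{R}^n:\,S\subseteq B(x,1)}B(x,1)$, where the intersection of an empty family is $\mathbb{R}^n$. A set $S$ is b-convex if $S=\operatorname{bh}_1(S)$; a b-convex body is a bounded non-empty b-convex set. A supporting sphere of a b-convex body $K$ is a sphere $S(x,1)$ of radius $1$ with $K\subseteq B(x,1)$ and $K\cap S(x,1)\neq\emptyset$. The circumradius $\operatorname{rad}(S)$ is the least $r\ge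 0$ such that $S$ is contained in some ball $B(x,r)$ (and $+\infty$ if $S$ is unbounded). A set $S$ is b-bounded if $\operatorname{rad}(S)<1$. *)

(* Defs.v *)
From HB Require Import structures.
From mathcomp Require Import all_boot all_order all_algebra.
From mathcomp Require Import all_classical all_reals ereal normedtype.

Set Implicit Arguments.
Unset Strict Implicit.
Unset Printing Implicit Defensive.

Import Order.TTheory GRing.Theory Num.Theory.
Import numFieldNormedType.Exports.

Local Open Scope classical_set_scope.
Local Open Scope ring_scope.

Record rV_norm (R : realType) (n : nat) := RVNorm {
  rV_norm_fun :> 'rV[R]_n -> R ;
  rV_normD : forall x y, rV_norm_fun (x + y) <= rV_norm_fun x + rV_norm_fun y ;
  rV_normZ : forall (a : R) x, rV_norm_fun (a *: x) = `|a| * rV_norm_fun x ;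
  rV_norm_eq0 : forall x, rV_norm_fun x = 0 -> x = 0
}.

(* An alias of 'rV[R]_n: on [minkowski_space N] the notation `|x|, the topology
   and boundedness are those of N, not those of the sup norm that the library
   puts on 'rV[R]_n. *)
Definition minkowski_space (R : realType) (n : nat) (N : rV_norm R n) : Type :=
  'rV[R]_n.

HB.instance Definition _ (R : realType) (n : nat) (N : rV_norm R n) :=
  GRing.Lmodule.on (minkowski_space N).

HB.instance Definition _ (R : realType) (n : nat) (N : rV_norm R n) :=
  Lmodule_isNormed.Build R (minkowski_space N)
    (@rV_normD R n N) (@rV_normZ R n N) (@rV_norm_eq0 R n N).

Section BallConvexity.
Context {R : realType} {V : normedModType R}.
Implicit Types (x y : V) (r : R) (S K : set V).

(* The library's [closed_ball x r] is the closure of an open ball, hence empty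
   for r = 0, where the ball below is the singleton of x. *)
Definition cball x r : set V := [set y | `|y - x| <= r].

Definition sphere x r : set V := [set y | `|y - x| = r].

Definition bd S : set V := closure S `\` S°.

Definition ball_hull S : set V :=
  \bigcap_(x in [set x | S `<=` cball x 1]) cball x 1.

Definition b_convex S : Prop := S = ball_hull S.

Definition b_convex_body K : Prop :=
  [/\ b_convex K, bounded_set K & K !=set0].

(* The sphere is represented by its centre. *)
Definition supporting_sphere K x : Prop :=
  K `<=` cball x 1 /\ K `&` sphere x 1 !=set0.

(* In finite dimension the infimum is attained when S is bounded, so it is the
   least admissible radius; it is +oo when S is unbounded. *)
Definition circumradius S : \bar R :=
  ereal_inf [set r%:E | r in [set r : R | 0 <= r /\ exists x, S `<=` cball x r]].

Definition b_bounded S : Prop := (circumradius S < 1%:E)%E.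

End BallConvexity.

(* Main.v *)
Require Import Defs.
From mathcomp Require Import all_boot all_order all_algebra.
From mathcomp Require Import all_classical all_reals ereal normedtype.
From mathcomp Require Import derive lra.

Set Implicit Arguments.
Unset Strict Implicit.
Unset Printing Implicit Defensive.

Import Order.TTheory GRing.Theory Num.Theory.
Import numFieldNormedType.Exports.

Local Open Scope classical_set_scope.
Local Open Scope ring_scope.

(** Fix a b-convex body K and let C be the set of the centres of the unit
    balls that contain K, so that K is the intersection of those balls. In
    finite dimension both K and C are closed and bounded, hence compact, and
    the distance from a given point x to the points of C attains its maximum.
    Everything except this compactness holds in an arbitrary normed space.

    - If x lies in K and its distance to each point of C is less than 1, then
      the maximum is less than 1 too (or C is empty and K is the whole
      space), so a small ball around x stays in every unit ball that contains
      K, and x is interior to K. A boundary point is therefore at distance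
      exactly 1 from some point of C ([bd_supporting]).
    - If x lies outside K, some point of C is at distance more than 1 from x,
      and the point y of C farthest from x is the centre of a supporting
      sphere: if K did not touch the unit sphere around y, then by compactness
      of K the ball could be pushed a little further away from x and still
      contain K, contradicting the choice of y ([notin_supporting]).
    - If moreover K lies in a ball of centre z and radius r < 1, moving y
      slightly towards z makes K fit in a concentric ball of radius less than
      1, while x, by continuity, stays outside the unit ball
      ([notin_strict_cball]).

    Compactness of closed bounded sets for an arbitrary norm N on row vectors
    is the equivalence of N with the sup norm: N is continuous for the sup
    norm, so it has a positive minimum on the sup-norm unit sphere
    ([minkowski_heine_borel]). *)

Definition heine_borel (R : realType) (V : normedModType R) : Prop :=
  forall A : set V, bounded_set A -> closed A -> compact A.

(** * Unit balls containing a set *)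

Section NormedModule.
Context {R : realType} {V : normedModType R}.
Implicit Types (x y : V) (r : R) (A K : set V).

Lemma bounded_setP A : bounded_set A <-> exists M, forall x, A x -> `|x| <= M.
Proof.
split=> [[M [_ AM]]|[M AM]].
  by exists (M + 1) => x Ax; apply: (AM (M + 1)) => //; rewrite ltrDl.
exists M; split=> [|B MB x Ax]; first exact: num_real.
exact: le_trans (AM x Ax) (ltW MB).
Qed.

Lemma closed_cball x r : closed (cball x r).
Proof.
rewrite (_ : cball x r = closed_ball_ Num.norm x r).
  exact: closed_closed_ball_.
by apply/seteqP; split=> y; rewrite /cball /closed_ball_ /= distrC.
Qed.

Lemma cball_subset_interior x r s : r < s -> cball x r `<=` (cball x s)°.
Proof.
move=> rs y yr; apply/nbhs_ballP; exists (s - r) => /=.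
  by rewrite subr_gt0.
move=> z; rewrite -ball_normE /ball_ /= => yz; rewrite /cball /=.
rewrite distrC in yz; rewrite -(subrK y z) -addrA.
apply: le_trans (ler_normD _ _) _; move: yr; rewrite /cball /=; lra.
Qed.

Lemma compact_farthest A x : A !=set0 -> compact A ->
  exists2 a, A a & forall b, A b -> `|x - b| <= `|x - a|.
Proof.
move=> A0 Ac.
have cf : continuous (fun b : V => `|x - b|).
  move=> b; apply: (@continuous_comp _ _ _ (fun b => x - b) Num.norm).
    exact: (continuousB (@cst_continuous _ _ _ _)).
  exact: norm_continuous.
have [a aA amax] := compact_EVT_max A0 Ac (continuous_subspaceT cf).
by exists a => [|b bA]; [exact: set_mem|apply: amax; exact: mem_set].
Qed.

Definition covering_centres K : set V := [set y | K `<=` cball y 1].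

Lemma b_convex_notin K x : b_convex K -> ~ K x ->
  exists2 y, covering_centres K y & 1 < `|x - y|.
Proof.
move=> bK; rewrite {1}bK /ball_hull -[~ _]/((~` _) x) setC_bigcap => -[y Ky].
by rewrite /cball /= => /negP; rewrite -ltNge; exists y.
Qed.

Lemma closed_b_convex K : b_convex K -> closed K.
Proof. by move=> ->; apply: closed_bigI => x _; exact: closed_cball. Qed.

(** By symmetry of the distance, the covering centres form a b-convex set,
    which makes them closed and, when K is nonempty, bounded. *)
Lemma covering_centresE K : covering_centres K = \bigcap_(k in K) cball k 1.
Proof.
apply/seteqP; split=> y Ky k Kk; rewrite /cball /= distrC; exact: (Ky k Kk).
Qed.

Lemma compact_covering_centres K :
  heine_borel V -> K !=set0 -> compact (covering_centres K).
Proof.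
move=> HB [k Kk]; apply: HB; last first.
  by rewrite covering_centresE; apply: closed_bigI => x _; exact: closed_cball.
apply/bounded_setP; exists (`|k| + 1) => y Ky.
have := ler_normB k (k - y); rewrite subKr => /le_trans; apply.
by rewrite lerD2l; exact: Ky.
Qed.

(** If no covering centre is at distance 1 from x, the covering centre farthest
    from x leaves a uniform margin around x, which is then interior to K. *)
Lemma bd_supporting K x : heine_borel V -> K !=set0 -> b_convex K -> bd K x ->
  exists2 y, supporting_sphere K y & sphere y 1 x.
Proof.
move=> HB K0 bK [clx nintx].
have {clx} Kx : K x.
  by move: clx; rewrite -(proj1 (closure_id _) (closed_b_convex bK)).
have [[y Ky xy]|noy] :=
  pselect (exists2 y, covering_centres K y & `|x - y| = 1).
  by exists y => //; split=> //; exists x.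
exfalso; apply: nintx.
have [C0|/set0P/negP/negPn/eqP C0] := pselect (covering_centres K !=set0).
  have [y Ky ymax] := compact_farthest x C0 (compact_covering_centres HB K0).
  have xy1 : `|x - y| < 1.
    rewrite lt_neqAle (Ky x Kx) andbT.
    by apply/eqP => xy; apply: noy; exists y.
  have: (cball x (1 - `|x - y|))° x.
    apply: (@cball_subset_interior x 0); first by rewrite subr_gt0.
    by rewrite /cball /= subrr normr0.
  apply: filterS => z; rewrite {1}bK /cball /= => zx c Kc.
  have := ymax c Kc; have := ler_normD (z - x) (x - c).
  rewrite addrA subrK /cball /=; lra.
(* An empty intersection of balls is the whole space. *)
rewrite (_ : K = setT) ?interiorT// bK /ball_hull -/(covering_centres K) C0.
exact: bigcap_set0.
Qed.

(** The covering centre farthest from x gives a sphere that touches K: otherwise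
    that centre could be moved further away from x. *)
Lemma notin_supporting K x : heine_borel V -> b_convex_body K -> ~ K x ->
  exists2 y, supporting_sphere K y & ~ cball y 1 x.
Proof.
move=> HB [bK Kbd K0] Kx; have [y1 Ky1 xy1] := b_convex_notin bK Kx.
have C0 : covering_centres K !=set0 by exists y1.
have [y Ky ymax] := compact_farthest x C0 (compact_covering_centres HB K0).
have xy : 1 < `|x - y| := lt_le_trans xy1 (ymax _ Ky1).
exists y; last by rewrite /cball /= => /(lt_le_trans xy); rewrite ltxx.
split=> //.
have [k Kk kmax] := compact_farthest y K0 (HB _ Kbd (closed_b_convex bK)).
exists k; split=> //; rewrite /sphere /=; apply/eqP; rewrite eq_le (Ky k Kk) /=.
rewrite leNgt; apply/negP => ky.
have xy0 : 0 < `|x - y| by lra.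
(* The farthest point k of K from y leaves a gap 1 - |k - y|, which is the
   distance by which y can move away from x. *)
pose t := (1 - `|k - y|) / `|x - y|.
have t0 : 0 < t by rewrite divr_gt0// subr_gt0.
have tE : t * `|x - y| = 1 - `|k - y| by rewrite mulfVK// gt_eqF.
have Cy' : covering_centres K (y - t *: (x - y)).
  move=> l Kl; rewrite /cball /= opprB addrCA.
  have := ler_normD (t *: (x - y)) (l - y); have := kmax l Kl.
  rewrite normrZ (gtr0_norm t0) tE !(distrC y); lra.
have xy'E : x - (y - t *: (x - y)) = (1 + t) *: (x - y).
  by rewrite opprB addrCA [RHS]scalerDl scale1r [RHS]addrC.
have := ymax _ Cy'; rewrite xy'E normrZ gtr0_norm; last lra.
by rewrite mulrDl mul1r tE; lra.
Qed.

Lemma b_bounded_cball K : b_bounded K ->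
  exists z r, [/\ 0 <= r, r < 1 & K `<=` cball z r].
Proof.
move=> /ereal_inf_lt[_ [r [r0 [z Kz]] <-]]; rewrite lte_fin => r1.
by exists z, r.
Qed.

(** A covering centre y that leaves out x is moved slightly towards the centre
    z of a ball of radius r < 1 around K. *)
Lemma notin_strict_cball K x : b_convex K -> b_bounded K -> ~ K x ->
  exists y r, [/\ 0 < r, r < 1, K `<=` cball y r & ~ cball y 1 x].
Proof.
move=> bK /b_bounded_cball[z [r [r0 r1 Kz]]] Kx.
have [y Ky xy] := b_convex_notin bK Kx.
(* Moving y by t (z - y) lowers its distance to x by at most t |z - y|, which
   must stay below |x - y| - 1; the added |x - y| in the denominator makes
   t < 1. *)
have [t [t0 t1 tE]] : exists t,
    [/\ 0 < t, t < 1 & t * (`|x - y| + `|z - y|) = `|x - y| - 1].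
  have zy0 := normr_ge0 (z - y).
  exists ((`|x - y| - 1) / (`|x - y| + `|z - y|)); split.
  - by rewrite divr_gt0//; lra.
  - by rewrite ltr_pdivrMr; lra.
  - by rewrite mulfVK// gt_eqF//; lra.
exists (y + t *: (z - y)), ((1 - t) + t * r); split; [nra|nra| |].
  move=> k Kk; rewrite /cball /=.
  have -> : k - (y + t *: (z - y)) = (1 - t) *: (k - y) + t *: (k - z).
    rewrite scalerBl scale1r -addrA -scalerN -scalerDr opprB addrA subrK.
    by rewrite opprD addrA -scalerN opprB.
  apply: le_trans (ler_normD _ _) _.
  rewrite !normrZ (gtr0_norm t0) (@gtr0_norm _ (1 - t)) ?subr_gt0//.
  by apply: lerD; [apply: ler_piMr; [lra|exact: Ky]
                  |apply: ler_wpM2l; [exact: ltW|exact: Kz]].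
rewrite /cball /= opprD addrA.
have := lerB_dist (x - y) (t *: (z - y)).
rewrite normrZ (gtr0_norm t0) => xyz /(le_trans xyz).
have : t * `|z - y| < `|x - y| - 1 by nra.
lra.
Qed.

End NormedModule.

(** * Compactness in Minkowski spaces *)

Section FiniteDimension.
Context {R : realType} {n : nat}.

(** Linear maps out of row vectors are continuous whatever the norm of their
    target: written in the canonical basis, they are finite sums of
    coordinates. *)
Lemma linear_combination_continuous (V : normedModType R) (v : 'I_n -> V) :
  continuous (fun x : 'rV[R]_n => \sum_(j < n) x ord0 j *: v j).
Proof.
apply: continuous_big => [x|j _ x]; first exact: add_continuous.
by apply: continuousZr_tmp; exact: coord_continuous.
Qed.

Context (N : rV_norm R n).

(** The identity, seen as a map between the two topologies, sup norm and N. *)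
Definition to_minkowski (x : 'rV[R]_n) : minkowski_space N := x.

Lemma to_minkowski_continuous : continuous to_minkowski.
Proof.
rewrite (_ : to_minkowski =
  fun x => \sum_(j < n) x ord0 j *: to_minkowski (delta_mx 0 j)).
  exact: linear_combination_continuous.
by apply/funext => x; rewrite /to_minkowski [LHS]row_sum_delta.
Qed.

(** By homogeneity the constant is the minimum of N on the unit sphere of the
    sup norm, which is compact. *)
Lemma sup_norm_le_minkowski :
  exists2 c : R, 0 < c & forall x : 'rV[R]_n, c * `|x| <= `|to_minkowski x|.
Proof.
pose S := [set x : 'rV[R]_n | `|x| = 1].
have cS : compact S.
  apply: bounded_closed_compact.
    by apply/bounded_setP; exists 1 => x /= ->.
  rewrite (_ : S = Num.norm @^-1` [set 1])//.
  apply: preimage_closed => [x _|]; last exact: closed_eq.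
  exact: norm_continuous.
have normalize (x : 'rV[R]_n) : x != 0 -> S (`|x|^-1 *: x).
  by move=> x0; rewrite /S /= normrZ normfV normr_id mulVf ?normr_eq0.
(* The sphere is empty when n = 0; any constant then works. *)
have [S0|nS] := pselect (S !=set0); last first.
  exists 1 => // x; have [->|x0] := eqVneq x 0; first by rewrite normr0 mulr0.
  by exfalso; apply: nS; exists (`|x|^-1 *: x); exact: normalize.
have cN : continuous (fun x : 'rV[R]_n => `|to_minkowski x|).
  move=> x; apply: (@continuous_comp _ _ _ to_minkowski Num.norm).
    exact: to_minkowski_continuous.
  exact: norm_continuous.
have [c cS' cmin] := compact_EVT_min S0 cS (continuous_subspaceT cN).
have c0 : c != 0.
  apply/eqP => c0; move: cS'; rewrite inE /S /= c0 normr0 => /eqP.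
  by rewrite eq_sym oner_eq0.
exists `|to_minkowski c|; first by rewrite normr_gt0.
move=> x; have [->|x0] := eqVneq x 0; first by rewrite normr0 mulr0.
have := cmin _ (mem_set (normalize x x0)).
rewrite -[to_minkowski (_ *: _)]/(`|x|^-1 *: to_minkowski x).
by rewrite normrZ normfV normr_id ler_pdivlMl ?normr_gt0// mulrC.
Qed.

(** Continuity of the identity transfers closedness from N to the sup norm,
    and the lower bound on N transfers boundedness; the identity then carries
    compactness back to N. *)
Lemma minkowski_heine_borel : heine_borel (minkowski_space N).
Proof.
move=> A Abd Acl; have [c c0 cN] := sup_norm_le_minkowski.
rewrite -[A]image_id; apply: (@continuous_compact _ _ to_minkowski A).
  exact: continuous_subspaceT to_minkowski_continuous.
apply: bounded_closed_compact.
  have /bounded_setP[M AM] := Abd.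
  apply/bounded_setP; exists (c^-1 * M) => x Ax.
  by rewrite ler_pdivlMl//; apply: le_trans (cN x) (AM x Ax).
apply: (@preimage_closed _ _ to_minkowski A _ Acl) => x _.
exact: to_minkowski_continuous.
Qed.

End FiniteDimension.

Theorem proposition1 (R : realType) (n : nat) (n_ge1 : (1 <= n)%N)
    (N : rV_norm R n) (K : set (minkowski_space N)) (HK : b_convex_body K) :
  [/\ forall x0 : minkowski_space N, bd K x0 ->
        exists y0 : minkowski_space N, supporting_sphere K y0 /\ sphere y0 1 x0,
      forall x0 : minkowski_space N, ~ K x0 ->
        exists y0 : minkowski_space N, supporting_sphere K y0 /\ ~ cball y0 1 x0
    & b_bounded K ->
      forall x0 : minkowski_space N, ~ K x0 ->
        exists y0 : minkowski_space N,
          [/\ K `<=` (cball y0 1)°, ~ cball y0 1 x0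
            & exists r : R, [/\ 0 < r, r < 1 & K `<=` cball y0 r]]].
Proof.
have HB := @minkowski_heine_borel R n N; have [bK _ K0] := HK; split.
- by move=> x0 /(bd_supporting HB K0 bK)[y]; exists y.
- by move=> x0 /(notin_supporting HB HK)[y]; exists y.
move=> Kr x0 /(notin_strict_cball bK Kr)[y [r [r0 r1 Ky xy]]].
exists y; split=> //; last by exists r.
by apply: subset_trans Ky _; exact: cball_subset_interior.
Qed.
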